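(* For every integer $\ell\geq 2$, every $F_\ell$-induced-minor-free graph $G$, and every weighting $\mathsf{w}$ of $G$, there is a $\mathsf{w}$-balanced separator $S$ of $G$ that is dominated by at most $\ell$ vertices, i.e. $S\subseteq N[D]$ for some $D\subseteq V(G)$ with $|D|\leq\ell$.
   Context: All graphs are finite and simple. For $\ell\geq 2$, $F_\ell$ (the $\ell$-fan) is the graph obtained from a path on $\ell$ vertices by adding a vertex adjacent to all vertices of the path. A graph $H$ is an induced minor of $G$ if $H$ is isomorphic to a graph obtained from $G$ by deleting vertices and contracting edges; $G$ is $H$-induced-minor-free if $H$ is not an induced minor of $G$. A weighting is a function $\mathsf{w}\colon V(G)\to\mathbb{R}_{\geq0}$; $\mathsf{w}(A)=\sum_{x\in A}\mathsf{w}(x)$. A subgraph $H$ is heavy if $\mathsf{w}(H)>\frac12\mathsf{w}(V(G))$. A set $S$ is a $\mathsf{w}$-balanced separator if no component of $G-S$ is heavy. $N[D]$ is the closed neighbourhood of $D$. *)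

(* Defs.v *)
From HB Require Import structures.
From mathcomp Require Import all_boot all_order all_algebra.
From mathcomp Require Import reals.

Set Implicit Arguments.
Unset Strict Implicit.
Unset Printing Implicit Defensive.

Import Order.TTheory GRing.Theory Num.Theory.

Record sgraph := SGraph {
  vertex :> finType;
  edge : rel vertex;
  edge_sym : symmetric edge;
  edge_irrefl : irreflexive edge }.

Definition isomorphic (G H : sgraph) : Prop :=
  exists2 f : G -> H, bijective f & forall x y, edge (f x) (f y) = edge x y.

Section Operations.
Variable G : sgraph.

Section Induced.
Variable A : {set G}.

Definition induced_edge : rel {x : G | x \in A} :=
  fun x y => edge (val x) (val y).

Lemma induced_edge_sym : symmetric induced_edge.
Proof. by move=> x y; apply: edge_sym. Qed.

Lemma induced_edge_irrefl : irreflexive induced_edge.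
Proof. by move=> x; apply: edge_irrefl. Qed.

Definition induced : sgraph := SGraph induced_edge_sym induced_edge_irrefl.
End Induced.

Definition delete (S : {set G}) : sgraph := induced (~: S).

(* Contraction of the edge uv: v is removed and u plays the role of the
   merged vertex.  Loops and parallel edges are suppressed. *)
Section Contract.
Variables u v : G.

Definition contract_edge : rel {x : G | x \in [set~ v]} :=
  fun x y => (x != y) &&
    [|| edge (val x) (val y),
        (val x == u) && edge v (val y)
      | (val y == u) && edge v (val x)].

Lemma contract_edge_sym : symmetric contract_edge.
Proof.
by move=> x y; rewrite /contract_edge eq_sym edge_sym; congr (_ && (_ || _)); rewrite orbC.
Qed.

Lemma contract_edge_irrefl : irreflexive contract_edge.
Proof. by move=> x; rewrite /contract_edge eqxx. Qed.

Definition contract : sgraph := SGraph contract_edge_sym contract_edge_irrefl.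
End Contract.

Definition closed_nbh (D : {set G}) : {set G} :=
  [set x | (x \in D) || [exists y in D, edge y x]].

Definition components : {set {set G}} :=
  [set [set y | connect (@edge G) x y] | x : G].

End Operations.

(* [induced_minor H G]: some sequence of vertex deletions and edge
   contractions turns G into a graph isomorphic to H. *)
Inductive induced_minor (H : sgraph) : sgraph -> Prop :=
| IMIso (G : sgraph) : isomorphic H G -> induced_minor H G
| IMDelete (G : sgraph) (v : G) :
    induced_minor H (delete [set v]) -> induced_minor H G
| IMContract (G : sgraph) (u v : G) :
    edge u v -> induced_minor H (contract u v) -> induced_minor H G.

Section Fan.
Variable l : nat.

(* [Some i] is the i-th vertex of the path, [None] is the vertex adjacent to
   the whole path. *)
Definition fan_edge : rel (option 'I_l) := fun x y =>
  match x, y with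
  | Some i, Some j => (i.+1 == j :> nat) || (j.+1 == i :> nat)
  | None, None => false
  | _, _ => true
  end.

Lemma fan_edge_sym : symmetric fan_edge.
Proof. by case=> [i|] [j|] //=; rewrite orbC. Qed.

Lemma fan_edge_irrefl : irreflexive fan_edge.
Proof. by case=> [i|] //=; rewrite orbb eqn_leq ltnn. Qed.

Definition fan : sgraph := SGraph fan_edge_sym fan_edge_irrefl.
End Fan.

Section Weight.
Variables (R : realType) (G : sgraph) (w : G -> R).
Local Open Scope ring_scope.

Definition weight (A : {set G}) : R := \sum_(x in A) w x.

Definition heavy (A : {set G}) : bool := weight A > 2^-1 * weight [set: G].

(* Components of G - S are sets of vertices of the graph [delete S]; [val]
   sends them back to sets of vertices of G. *)
Definition balanced_separator (S : {set G}) : Prop :=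
  forall C : {set delete S}, C \in components (delete S) ->
    ~~ heavy [set val x | x in C].

End Weight.

(* Main.v *)
Require Import Defs.
From mathcomp Require Import all_boot all_order all_algebra.
From mathcomp Require Import reals.
From mathcomp Require boolp.
From mathcomp Require Import zify lra.

(** A Gyárfás-path descent.  Assuming that no separator dominated by [l] vertices
is balanced, maintain a heavy connected set [C], an induced path [s q] of which
only the end [q] touches [C], and a set [D] of vertices of [s] dominating
[N(C) \ q] such that every vertex of [D] has a neighbour in [N(C) \ q].
Contracting [C] and [N(C) \ q] to a hub, and cutting the path into segments
containing one vertex of [D] each, gives a fan with [#|D|] path vertices, so
[#|D| < l].  Hence [N[D + q]] is not balanced and leaves a heavy component [C'],
strictly inside [C]; a neighbour of [C'] in [C] must be adjacent to [q] and
extends the path.  The vertices of [D + q] that are no longer needed to dominate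
the neighbourhood of [C'] are dropped, and the process cannot go on forever. *)

Set Implicit Arguments.
Unset Strict Implicit.
Unset Printing Implicit Defensive.

Import Order.TTheory GRing.Theory Num.Theory.

(** * Bag models and the induced minors they produce *)

Definition fiber_edge (G : sgraph) (T : eqType) (f : G -> T) : rel G :=
  [rel x y | edge x y && (f x == f y)].

Lemma fiber_edge_sym (G : sgraph) (T : eqType) (f : G -> T) :
  symmetric (fiber_edge f).
Proof. by move=> x y; rewrite /fiber_edge /= edge_sym eq_sym. Qed.

(* The bags of the model are the fibers over [Some _]; vertices mapped to
   [None] are to be deleted. *)
Record minor_model (H G : sgraph) (f : G -> option H) : Prop := MinorModel {
  mm_surj : forall h, exists x, f x = Some h;
  mm_conn : forall x y h, f x = Some h -> f y = Some h ->
    connect (fiber_edge f) x y;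
  mm_edge : forall x y a b, f x = Some a -> f y = Some b -> edge x y ->
    a = b \/ edge a b;
  mm_lift : forall a b, edge a b ->
    exists x y, [/\ f x = Some a, f y = Some b & edge x y] }.

Lemma minor_model_delete (H G : sgraph) (f : G -> option H) (v : G) :
  minor_model f -> f v = None ->
  minor_model (fun x : delete [set v] => f (val x)).
Proof.
move=> [surj conn adj lift] fv.
have in_del x h : f x = Some h -> x \in ~: [set v].
  by rewrite !inE; case: eqP => // ->; rewrite fv.
split.
- move=> h; have [x fx] := surj h.
  by exists (Sub x (in_del _ _ fx)); rewrite SubK.
- move=> x y h fx fy; have /connectP[p] := conn _ _ _ fx fy.
  elim: p x fx => [|z p IHp] x fx /=.
    by move=> _ /val_inj->.
  case/andP=> /andP[exz /eqP fxz] pathp ylast.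
  have fz : f z = Some h by rewrite -fxz.
  pose z' : delete [set v] := Sub z (in_del _ _ fz).
  have z'E : val z' = z by rewrite SubK.
  apply: (connect_trans (y := z')).
    by apply: connect1; rewrite /fiber_edge /= /induced_edge z'E exz fxz /=.
  by apply: IHp; rewrite z'E.
- by move=> x y a b; apply: adj.
- move=> a b /lift[x [y [fx fy exy]]].
  by exists (Sub x (in_del _ _ fx)), (Sub y (in_del _ _ fy)); rewrite !SubK.
Qed.

(** Since [f] agrees on [u] and [v], it factors through the map sending [v] to [u]; walks and edges
    of [G] are pushed along that map. *)
Lemma minor_model_contract (H G : sgraph) (f : G -> option H) (u v : G) :
  minor_model f -> edge u v -> f u = f v ->
  minor_model (fun x : contract u v => f (val x)).
Proof.
move=> [surj conn adj lift] euv fuv.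
have unv : u \in [set~ v] by rewrite !inE; apply: contraTneq euv => ->; rewrite edge_irrefl.
(* Only [v] lies outside the carrier, so the default of [insubd] applies exactly there and sends [v]
   to [u]. *)
pose proj x : contract u v := insubd (Sub u unv : contract u v) x.
have projE x : val (proj x) = if x == v then u else x.
  by rewrite val_insubd !inE; case: eqP.
have fproj x : f (val (proj x)) = f x.
  by rewrite projE; case: eqP => [->|].
have projK (x : contract u v) : proj (val x) = x.
  by apply: val_inj; rewrite projE; have := valP x; rewrite !inE => /negPf->.
have proj_edge x y : edge x y -> proj x != proj y -> edge (proj x) (proj y).
  move=> exy nxy; rewrite /= /contract_edge nxy /= !projE.
  case: (x =P v) => [xv|_]; case: (y =P v) => [yv|_].
  - by rewrite xv yv edge_irrefl in exy.
  - by apply/or3P/Or32; rewrite eqxx -xv.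
  - by apply/or3P/Or33; rewrite eqxx -yv edge_sym.
  - by apply/or3P/Or31.
split.
- by move=> h; have [x fx] := surj h; exists (proj x); rewrite fproj.
- move=> x y h fx fy; have /connectP[p pathp ylast] := conn _ _ _ fx fy.
  rewrite -(projK x) -(projK y) ylast.
  elim: p (val x) pathp {ylast} => [|z p IHp] x' /=; first by rewrite connect0.
  case/andP=> /andP[exz /eqP fxz] pathp; apply: connect_trans (IHp z pathp).
  have [->|nxz] := eqVneq (proj x') (proj z); first exact: connect0.
  by apply: connect1; rewrite /fiber_edge /= !fproj fxz eqxx andbT; apply: proj_edge.
- move=> x y a b fx fy /andP[_ /or3P[exy|/andP[/eqP xu evy]|/andP[/eqP yu evx]]].
  + exact: adj exy.
  + by apply: adj evy; rewrite // -fuv -xu.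
  + by apply: (adj (val x) v); rewrite // 1?edge_sym // -fuv -yu.
- move=> a b eab; have [x [y [fx fy exy]]] := lift _ _ eab.
  exists (proj x), (proj y); rewrite !fproj; split=> //; apply: proj_edge => //.
  apply: contraTneq eab => exy'.
  have /eqP : f x = f y by rewrite -fproj exy' fproj.
  by rewrite fx fy => /eqP[->]; rewrite edge_irrefl.
Qed.

(** Induction on [#|G|]: delete a vertex outside all bags, else contract an edge inside a bag. When
    neither exists, every bag is a single vertex, and picking it gives the isomorphism. *)
Lemma minor_model_induced_minor (H G : sgraph) (f : G -> option H) :
  minor_model f -> induced_minor H G.
Proof.
have [n leGn] := ubnP #|G|; elim: n => // n IHn in G f leGn *.
(* Deletion and contraction have the same carrier, all vertices but [v], so one bound serves
   both. *)
have shrink (v : G) : #|{: {x : G | x \in ~: [set v]}}| < n.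
  rewrite card_sig; apply: (@leq_trans #|G|); last by rewrite -ltnS.
  apply: proper_card; apply/properP; split; first exact/subsetP.
  by exists v; rewrite // !inE eqxx.
move=> fM; have [[v /eqP fv]|allS] := altP (@existsP G (fun v => f v == None)).
  by apply: (@IMDelete _ _ v); apply: IHn (minor_model_delete fM fv); apply: shrink.
have [[u /existsP[v /andP[euv /eqP fuv]]]|inj] :=
    altP (@existsP G (fun u => [exists v, fiber_edge f u v])).
  by apply: (IMContract euv); apply: IHn (minor_model_contract fM euv fuv); apply: shrink.
(* A nontrivial walk inside a bag would start with an edge that can still be contracted. *)
have f_inj x y h : f x = Some h -> f y = Some h -> x = y.
  move=> fx fy; have /connectP[[|z p] //= /andP[exz _] _] := mm_conn fM fx fy.
  by case/negP: inj; apply/existsP; exists x; apply/existsP; exists z.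
have gP h : exists x, f x == Some h by have [x /eqP fx] := mm_surj fM h; exists x.
pose g h := xchoose (gP h).
have fg h : f (g h) = Some h by apply/eqP; exact: (xchooseP (gP h)).
apply: IMIso; exists g.
  have g_inj : injective g by move=> a b gab; apply/Some_inj; rewrite -!fg gab.
  apply: inj_card_bij => //; rewrite -(card_codom g_inj).
  apply: subset_leq_card; apply/subsetP => x _; apply/codomP.
  have /existsPn /(_ x) := allS; case fx: (f x) => [h|//] _.
  by exists h; apply: f_inj fx (fg h).
move=> a b; apply/idP/idP => [egab | eab].
  have [abE|//] := mm_edge fM (fg a) (fg b) egab.
  by rewrite abE edge_irrefl in egab.
have [x [y [fx fy exy]]] := mm_lift fM eab.
by rewrite (f_inj _ _ _ (fg a) fx) (f_inj _ _ _ (fg b) fy).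
Qed.

(** * Connected vertex sets *)

Definition connected_set (G : sgraph) (A : {set G}) : Prop :=
  forall x y, x \in A -> y \in A ->
    connect [rel a b | [&& edge a b, a \in A & b \in A]] x y.

(** Take the first edge leaving [B] on a walk inside [A] from [x] to [y]. *)
Lemma connected_set_crossing (G : sgraph) (A B : {set G}) (x y : G) :
  connected_set A -> x \in A -> x \in B -> y \in A -> y \notin B ->
  exists a b, [/\ a \in A :&: B, b \in A :\: B & edge a b].
Proof.
move=> connA xA xB yA; have /connectP[p] := connA x y xA yA.
elim: p x xA xB => [|z p IHp] x xA xB /=; first by move=> _ ->; rewrite xB.
case/andP=> /and3P[exz _ zA] pathp ylast yB.
have [zB|zB] := boolP (z \in B); first exact: IHp zA zB pathp ylast yB.
by exists x, z; rewrite !inE xA xB zA zB.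
Qed.

Lemma connected_setU (G : sgraph) (A B : {set G}) :
  connected_set A -> (forall y, y \in B -> exists2 x, x \in A & edge x y) ->
  connected_set (A :|: B).
Proof.
move=> connA domB; pose e := [rel a b : G | [&& edge a b, a \in A :|: B & b \in A :|: B]].
have e_sym : connect_sym e.
  by apply: sym_connect_sym => a b; rewrite /e /= edge_sym; congr andb; rewrite andbC.
have toA y : y \in A :|: B -> exists2 x, x \in A & connect e x y.
  rewrite inE => /orP[yA|/[dup] yB /domB[x xA exy]]; first by exists y.
  by exists x => //; apply: connect1; rewrite /e /= exy !inE xA yB orbT.
move=> x y; rewrite -/e => /toA[x' x'A cx] /toA[y' y'A cy].
apply: connect_trans cy; rewrite e_sym in cx; apply: connect_trans cx _.
apply: connect_sub (connA _ _ x'A y'A) => a b /= /and3P[eab aA bA].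
by apply: connect1; rewrite /e /= eab !inE aA bA.
Qed.

(** * Fans from an induced path and a connected hub *)

Lemma count_take_nth (T : Type) (x0 : T) (P : pred T) (s : seq T) (i : nat) :
  i < count P s ->
  exists j, [/\ j < size s, P (nth x0 s j) & count P (take j s) = i].
Proof.
elim: s i => [|x s IHs] //= i.
have [Px|Px] := boolP (P x).
  case: i => [|i]; first by exists 0; split.
  rewrite add1n ltnS => /IHs[j [ltjs Pj <-]].
  by exists j.+1; rewrite /= Px.
rewrite add0n => /IHs[j [ltjs Pj <-]].
by exists j.+1; rewrite /= (negPf Px).
Qed.

Definition induced_path (G : sgraph) (s : seq G) : Prop :=
  uniq s /\ forall x0 i j, i < size s -> j < size s ->
    edge (nth x0 s i) (nth x0 s j) = (i.+1 == j) || (j.+1 == i).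

(** [A] becomes the hub. The path is cut just after each vertex of [D], so every segment ends in its
    only vertex of [D], which supplies both the edge to the hub and the edge to the next segment. *)
Lemma fan_induced_minor (G : sgraph) (s : seq G) (D A : {set G}) :
  induced_path s -> {subset D <= s} -> connected_set A ->
  (exists x, x \in A) -> (forall x, x \in s -> x \notin A) ->
  (forall d, d \in D -> exists2 x, x \in A & edge x d) ->
  induced_minor (fan #|D|) G.
Proof.
move=> [uniqs paths] Ds connA [a aA] sA domD.
(* [take j s] stops before position [j], so a vertex of [D] still belongs to the segment it
   closes. *)
pose rank j := count (mem D) (take j s).
have cntD : count (mem D) s = #|D|.
  rewrite -size_filter -(card_uniqP (filter_uniq _ uniqs)); apply: eq_card => x.
  by rewrite mem_filter; apply: andb_idr; apply: Ds.
have rankS j : j < size s -> rank j.+1 = (nth a s j \in D) + rank j.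
  move=> ltj; rewrite /rank (take_nth a) // -cats1 count_cat /= addn0 addnC //.
have rank_mono : {homo rank : j k / j <= k}.
  move=> j k lejk; rewrite /rank -(subnKC lejk) takeD count_cat; exact: leq_addr.
(* On the path, [insub] fails only at rank [#|D|], that is, after the last vertex of [D]; this tail
   is deleted. *)
pose f x : option (fan #|D|) := if x \in A then Some None else
  if x \in s then omap Some (insub (rank (index x s))) else None.
have fA x : x \in A -> f x = Some None by rewrite /f => ->.
have fAP x : f x = Some None -> x \in A.
  by rewrite /f; case: ifP => // _; case: ifP => // _; case: insub.
have fs j (i : 'I_#|D|) : j < size s -> rank j = i -> f (nth a s j) = Some (Some i).
  move=> ltj rj; rewrite /f (negPf (sA _ (mem_nth a ltj))) mem_nth //.
  by rewrite index_uniq // rj valK.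
have fsP x (i : 'I_#|D|) : f x = Some (Some i) ->
    exists j, [/\ j < size s, x = nth a s j & rank j = i].
  rewrite /f; case: ifP => // _; case: ifP => // xs.
  case: insubP => // i' _ ri [<-].
  by exists (index x s); rewrite index_mem nth_index.
have lastD (i : 'I_#|D|) : exists j, [/\ j < size s, nth a s j \in D & rank j = i].
  by apply: count_take_nth; rewrite cntD.
apply: (@minor_model_induced_minor _ _ f); split.
- case=> [i|]; last by exists a; apply: fA.
  by have [j [ltj _ rj]] := lastD i; exists (nth a s j); apply: fs.
- move=> x y [i|].
    move=> /fsP[j [ltj -> rj]] /fsP[k [ltk -> rk]].
    wlog lejk : j k ltj rj ltk rk / j <= k.
      move=> W; case: (leqP j k) => [|/ltnW]; first exact: W.
      rewrite (sym_connect_sym (@fiber_edge_sym _ _ f)); exact: W.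
    elim: k lejk ltk rk => [|k IHk]; first by rewrite leqn0 => /eqP->.
    rewrite leq_eqVlt => /predU1P[->|lejk] // ltk rk.
    (* By monotonicity [rank k] is squeezed between [rank j] and [rank k.+1], both equal to [i]. *)
    have {}rk' : rank k = i.
      by apply/eqP; rewrite eqn_leq -{1}rk -rj !rank_mono.
    apply: connect_trans (IHk lejk (ltnW ltk) rk') _; apply: connect1.
    apply/andP; split; first by rewrite paths ?(ltnW ltk) // eqxx.
    by rewrite (fs k i) ?(ltnW ltk) // (fs k.+1 i).
  move=> /fAP xA /fAP yA; apply: connect_sub (connA _ _ xA yA).
  move=> u v /and3P[euv uA vA]; apply: connect1.
  by rewrite /fiber_edge /= euv !fA.
- move=> x y [i|] [i'|]; [|by right..|by left].
  move=> /fsP[j [ltj -> rj]] /fsP[k [ltk -> rk]]; rewrite paths //.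
  (* One position further the rank grows by 0 or 1: same segment or the next one. *)
  case/orP=> /eqP E; move: rj rk; rewrite -E rankS // => rj rk.
    case: (_ \in D) rk => rk; [right | left].
      by rewrite /= -rj -rk eqxx.
    by congr Some; apply: val_inj; rewrite /= -rj -rk.
  case: (_ \in D) rj => rj; [right | left].
    by rewrite /= -rj -rk eqxx orbT.
  by congr Some; apply: val_inj; rewrite /= -rj -rk.
- have lift_hub (i : 'I_#|D|) : exists x y, [/\ f x = Some (Some i), f y = Some None & edge x y].
    have [j [ltj jD rj]] := lastD i; have [x xA exj] := domD _ jD.
    by exists (nth a s j), x; rewrite (fs j i) // (fA x) // edge_sym.
  have lift_path (i i' : 'I_#|D|) : i.+1 = i' ->
      exists x y, [/\ f x = Some (Some i), f y = Some (Some i') & edge x y].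
    move=> ii'; have [j [ltj jD rj]] := lastD i.
    have rj' : rank j.+1 = i' by rewrite rankS // jD rj.
    have ltj' : j.+1 < size s.
      (* If [j] were the last position, [rank j.+1] would count all of [D], while [i'] is below
         [#|D|]. *)
      rewrite ltnNge; apply/negP => le_s; have := ltn_ord i'.
      by rewrite -rj' /rank take_oversize // cntD ltnn.
    exists (nth a s j), (nth a s j.+1).
    by rewrite (fs j i) // (fs j.+1 i') // paths // eqxx.
  move=> [i|] [i'|] //=.
  + case/orP=> /eqP; first exact: lift_path.
    by move=> /lift_path[x [y [fx fy exy]]]; exists y, x; rewrite edge_sym.
  + by move=> _; have [x [y [fx fy exy]]] := lift_hub i'; exists y, x; rewrite edge_sym.
Qed.

Lemma induced_path_rcons (G : sgraph) (s : seq G) (q r : G) :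
  induced_path (rcons s q) -> edge q r -> r \notin s ->
  (forall x, x \in s -> ~~ edge x r) ->
  induced_path (rcons (rcons s q) r).
Proof.
move=> [uniqs paths] eqr rs sr; split.
  rewrite rcons_uniq uniqs mem_rcons inE negb_or rs !andbT.
  by apply: contraTneq eqr => ->; rewrite edge_irrefl.
have edge_last x0 i : i < size (rcons s q) ->
    edge (nth x0 (rcons s q) i) r = (i.+1 == size (rcons s q)).
  rewrite size_rcons ltnS eqSS nth_rcons => lei.
  case: (ltngtP i (size s)) lei => // lti _.
  by apply/negbTE; apply: sr; rewrite mem_nth.
move=> x0 i j; rewrite size_rcons !ltnS !(nth_rcons x0 (rcons s q)).
case: ltngtP => // [lti|->] _; case: ltngtP => // [ltj|->] _.
- exact: paths.
- by rewrite edge_last //; lia.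
- by rewrite edge_sym edge_last //; lia.
- by rewrite edge_irrefl; lia.
Qed.

(** * Heavy components and the descent along a Gyárfás path *)

Section Weights.
Variables (R : realType) (G : sgraph) (w : G -> R).
Hypothesis w_ge0 : forall x, (0 <= w x)%R.

(** Two disjoint sets, each above half of the total weight, would together exceed it. *)
Lemma heavy_meet (A B : {set G}) : heavy w A -> heavy w B ->
  exists x, (x \in A) && (x \in B).
Proof.
rewrite /heavy => hA hB; apply/existsP; apply: contraT => /existsPn AB.
have : (weight w A + weight w B <= weight w [set: G])%R.
  rewrite /weight big_mkcond [X in (_ + X)%R]big_mkcond [leRHS]big_mkcond.
  rewrite -big_split /=; apply: ler_sum => x _.
  rewrite inE; have := AB x; have := w_ge0 x.
  by case: (x \in A); case: (x \in B) => //=; lra.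
lra.
Qed.

(** Moves a heavy component from the type [delete S] to a vertex set of [G]; the last clause records
    its maximality. *)
Lemma heavy_component (S : {set G}) : ~ balanced_separator w S ->
  exists C : {set G}, [/\ heavy w C, connected_set C,
    forall x, x \in C -> x \notin S &
    forall x y, x \in C -> edge x y -> y \in S \/ y \in C].
Proof.
move=> nbal.
have /existsP[K /andP[/imsetP[x0 _ KE] hK]] :
    [exists K : {set delete S}, (K \in components (delete S)) &&
       heavy w [set val x | x in K]].
  apply: contraT => /existsPn noK; case: nbal => K KS.
  by have := noK K; rewrite KS.
have inK (x : delete S) : (val x \in [set val x | x in K]) = connect (@edge (delete S)) x0 x.
  by rewrite mem_imset; [rewrite KE inE | apply: val_inj].
exists [set val x | x in K]; split=> //.
- have e_sym : connect_sym (@edge (delete S)).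
    by apply: sym_connect_sym; apply: edge_sym.
  move=> _ _ /imsetP[x xK ->] /imsetP[y yK ->].
  move: xK yK; rewrite KE !inE => cx cy.
  have : connect (@edge (delete S)) x y by apply: connect_trans cy; rewrite e_sym.
  case/connectP=> p; elim: p x cx => [|z p IHp] x cx /=; first by move=> _ ->.
  case/andP=> exz pathp yl; have cz := connect_trans cx (connect1 exz).
  apply: connect_trans (IHp z cz pathp yl); apply: connect1.
  by rewrite /= -KE !inK cx cz; move: exz; rewrite /= /induced_edge => ->.
- by move=> _ /imsetP[x _ ->]; have := valP x; rewrite inE.
- move=> _ y /imsetP[x xK ->] exy; have [yS|yS] := boolP (y \in S); first by left.
  right; have yS' : y \in ~: S by rewrite inE.
  have -> : y = val (Sub y yS' : delete S) by rewrite SubK.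
  rewrite inK; move: xK; rewrite KE inE => cx.
  by apply: connect_trans cx _; apply: connect1; rewrite /= /induced_edge SubK.
Qed.

(** [gs_dom] keeps the next heavy component inside [C], and [gs_need] joins each vertex of [D] to
    the hub of the fan. The end [q] is kept apart from [D] because it alone on the path touches
    [C]. *)
Record gyarfas_state (C D : {set G}) (s : seq G) (q : G) : Prop := GyarfasState {
  gs_heavy : heavy w C;
  gs_conn : connected_set C;
  gs_path : induced_path (rcons s q);
  gs_notin : forall x, x \in rcons s q -> x \notin C;
  gs_anti : forall x c, x \in s -> c \in C -> ~~ edge x c;
  gs_end : exists2 c, c \in C & edge q c;
  gs_sub : {subset D <= s};
  gs_dom : forall c y, c \in C -> y \notin C -> edge c y ->
    y = q \/ exists2 d, d \in D & edge d y;
  gs_need : forall d, d \in D ->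
    exists c y, [/\ c \in C, edge c y, y != q & edge d y] }.

(* The hub of the fan is [C] with its neighbours other than [q]. *)
Lemma gyarfas_state_fan (C D : {set G}) (s : seq G) (q : G) :
  gyarfas_state C D s q -> induced_minor (fan #|D|) G.
Proof.
move=> [_ connC path_sq notin anti [c0 c0C _] subD _ need].
apply: (@fan_induced_minor _ (rcons s q) _
  (C :|: [set y | (y != q) && [exists c in C, edge c y]])) => //.
- by move=> d /subD ds; rewrite mem_rcons inE ds orbT.
- apply: connected_setU => // y; rewrite inE => /andP[_ /existsP[c /andP[cC ecy]]].
  by exists c.
- by exists c0; rewrite inE c0C.
- move=> x xsq; rewrite !inE (negPf (notin x xsq)) /=.
  have [//|xq /=] := eqVneq x q.
  have xs : x \in s by move: xsq; rewrite mem_rcons inE (negPf xq).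
  apply/existsP => -[c /andP[cC]]; rewrite edge_sym; exact/negP/anti.
- move=> d /need[c [y [cC ecy yq edy]]]; exists y; last by rewrite edge_sym.
  by rewrite !inE yq /=; apply/orP; right; apply/existsP; exists c; rewrite cC.
Qed.

Lemma gyarfas_state_step (C D : {set G}) (s : seq G) (q : G) :
  gyarfas_state C D s q -> ~ balanced_separator w (closed_nbh (q |: D)) ->
  exists C' D' s' q',
    [/\ gyarfas_state C' D' s' q', #|C'| < #|C| & #|D'| <= #|D|.+1].
Proof.
move=> [heavyC connC path_sq notin anti [c0 c0C eqc0] subD domC _] /heavy_component.
set S := closed_nbh _; move=> [C' [heavyC' connC' C'S C'N]].
have qS : q \in S by rewrite !inE eqxx.
have NqS x : edge q x -> x \in S.
  by move=> eqx; rewrite inE; apply/orP; right; apply/existsP; exists q; rewrite !inE eqxx.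
have NDS d x : d \in D -> edge d x -> x \in S.
  by move=> dD edx; rewrite inE; apply/orP; right; apply/existsP; exists d; rewrite !inE dD orbT.
have [x0 /andP[x0C x0C']] := heavy_meet heavyC heavyC'.
(* An edge of [C'] leaving [C] would end in [q] or in a neighbour of [D], hence in [S], which [C']
   avoids. *)
have C'C : C' \subset C.
  apply/subsetP => y yC'; apply: contraT => yC.
  have [a [b [/setIP[aC' aC] /setDP[bC' bC] eab]]] :=
    connected_set_crossing connC' x0C' x0C yC' yC.
  have /negP[] := C'S b bC'.
  by have [->|[d dD edb]] := domC a b aC bC eab; last exact: NDS edb.
(* The neighbour [c0] of [q] is removed with [S], so [C'] is a proper part of [C] and an edge [a r]
   of [C] leaves it. *)
have c0C' : c0 \notin C' by apply: contraL (NqS _ eqc0); apply: C'S.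
have [a [r [/setIP[_ aC'] /setDP[rC rC'] ear]]] :=
  connected_set_crossing connC x0C x0C' c0C c0C'.
have subsq d : d \in q |: D -> d \in rcons s q.
  by rewrite mem_rcons !inE => /predU1P[->|/subD ->]; rewrite ?eqxx ?orbT.
have anti' x c : x \in rcons s q -> c \in C' -> ~~ edge x c.
  rewrite mem_rcons inE => /predU1P[->|xs] cC'; last exact: anti (subsetP C'C _ cC').
  by apply: contra (C'S c cC'); apply: NqS.
have domC' c y : c \in C' -> y \notin C' -> edge c y ->
    exists2 d, d \in q |: D & edge d y.
  move=> cC' yC' ecy; have [|yC] := C'N c y cC' ecy; last by rewrite yC in yC'.
  (* [y] is in [S] but not on the path, whose vertices have no neighbour in [C']; so some vertex of
     [q |: D] is adjacent to it. *)
  rewrite inE => /orP[/subsq ysq|/existsP[d /andP[dD edy]]]; last by exists d.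
  by have := anti' y c ysq cC'; rewrite edge_sym ecy.
(* [r] is dominated by [q |: D] and lies in [C], where vertices of [D] have no neighbours. *)
have eqr : edge q r.
  have [d] := domC' a r aC' rC' ear; rewrite !inE => /predU1P[->//|/subD ds edr].
  by have := anti d r ds rC; rewrite edr.
(* Dropping the other vertices enforces [gs_need] for the new end [r]; only [q] can be new. *)
pose D' := [set d in q |: D |
  [exists c in C', [exists y, [&& edge c y, y != r & edge d y]]]].
exists C', D', (rcons s q), r; split; last first.
- apply: leq_trans (subset_leq_card (_ : D' \subset q |: D)) _.
    by apply/subsetP => d; rewrite inE => /andP[].
  by rewrite cardsU1 -add1n leq_add2r leq_b1.
- by apply: proper_card; rewrite properE C'C; apply/subsetPn; exists r.
split=> //.
- apply: induced_path_rcons => //.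
    by apply: contraL rC => rs; apply: notin; rewrite mem_rcons inE rs orbT.
  by move=> x xs; apply: anti.
- move=> x; rewrite mem_rcons inE => /predU1P[->//|xsq].
  by apply: contra (notin x xsq); apply: (subsetP C'C).
- by exists a; rewrite // edge_sym.
- by move=> d; rewrite inE => /andP[/subsq].
- move=> c y cC' yC' ecy; have [->|yr] := eqVneq y r; [by left | right].
  have [d dD edy] := domC' c y cC' yC' ecy; exists d => //.
  rewrite inE dD /=; apply/existsP; exists c; rewrite cC' /=.
  by apply/existsP; exists y; rewrite ecy yr.
- move=> d; rewrite inE => /andP[_ /existsP[c /andP[cC' /existsP[y /and3P[ecy yr edy]]]]].
  by exists c, y.
Qed.

(** [C0] is a heavy component of [G] itself. It contains [v] and meets the heavy component [C] left
    after removing [v], so an edge leaves [C], and it can only end in [v]. The path starts as [v]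
    alone. *)
Lemma gyarfas_state_init :
  ~ balanced_separator w set0 -> (forall v, ~ balanced_separator w [set v]) ->
  exists C q, gyarfas_state C set0 [::] q.
Proof.
move=> /heavy_component[C0 [heavyC0 connC0 _ C0N]] nbal.
have [v /andP[vC0 _]] := heavy_meet heavyC0 heavyC0.
have [C [heavyC connC Cv CN]] := heavy_component (nbal v).
have vC : v \notin C by apply/negP => /Cv; rewrite inE eqxx.
have [x0 /andP[x0C0 x0C]] := heavy_meet heavyC0 heavyC.
have NC c y : c \in C -> y \notin C -> edge c y -> y = v.
  by move=> cC yC /(CN c y cC)[/set1P//|]; rewrite (negPf yC).
have [a [b [/setIP[_ aC] /setDP[_ bC] eab]]] :=
  connected_set_crossing connC0 x0C0 x0C vC0 vC.
exists C, v; split=> //.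
- by split=> // x0' [|//] [|//] _ _; rewrite edge_irrefl.
- by move=> x /[!inE] /eqP->.
- by exists a; rewrite // edge_sym -(NC a b aC bC eab).
- by move=> d; rewrite inE.
- by move=> c y cC yC /(NC c y cC yC); left.
- by move=> d; rewrite inE.
Qed.
End Weights.

Theorem theoremA1 (R : realType) (l : nat) (G : sgraph) (w : G -> R) :
  1 < l ->
  ~ induced_minor (fan l) G ->
  (forall x : G, (0 <= w x)%R) ->
  exists S : {set G},
    balanced_separator w S /\
    exists D : {set G}, #|D| <= l /\ S \subset closed_nbh D.
Proof.
move=> l_gt1 no_fan w_ge0; apply: boolp.contrapT => no_sep.
have nbal (S D : {set G}) : #|D| <= l -> S \subset closed_nbh D ->
    ~ balanced_separator w S.
  by move=> leD SD balS; apply: no_sep; exists S; split=> //; exists D.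
(* Each step shrinks [C], so induction on [#|C|] excludes every state with fewer than [l] vertices
   in [D]. *)
have no_state C D s q : gyarfas_state w C D s q -> #|D| < l -> False.
  have [n] := ubnP #|C|; elim: n => // n IHn in C D s q * => ltC st ltD.
  have nbalN : ~ balanced_separator w (closed_nbh (q |: D)).
    apply: (nbal _ (q |: D)) => //; rewrite cardsU1.
    by apply: leq_trans ltD; rewrite -add1n leq_add2r leq_b1.
  have [C' [D' [s' [q' [st' ltC' leD']]]]] := gyarfas_state_step w_ge0 st nbalN.
  (* [D] gains at most one vertex per step, so if the bound fails, then [#|D'|] is exactly [l] and
     the fan is the forbidden one. *)
  have := leq_trans leD' ltD; rewrite leq_eqVlt => /predU1P[D'l|].
    by apply: no_fan; rewrite -D'l; apply: gyarfas_state_fan st'.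
  by apply: IHn st'; apply: leq_trans ltC' _.
have [||C [q st]] := @gyarfas_state_init R G w w_ge0.
- by apply: (nbal _ set0); rewrite ?cards0 ?sub0set.
- move=> v; apply: (nbal _ [set v]); first by rewrite cards1 ltnW.
  by apply/subsetP => x xv; rewrite inE xv.
by apply: no_state st _; rewrite cards0 ltnW.
Qed.
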